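(* Consider the following encoder-assisted communication system over the additive white Gaussian noise (AWGN) channel. The channel is $Y_i = X_i + Z_i$, $i=1,\dots,n$, where $Z_1,\dots,Z_n$ are i.i.d. $\mathcal{N}(0,\sigma^2)$, $\sigma^2>0$. A helper observes the whole noise realization $z^n=(z_1,\dots,z_n)$ (non-causally) and sends to the encoder the index $T(z^n)$, where $T:\mathbb{R}^n\to\{0,1,\dots,e^{nR_{\mathrm{h}}}-1\}$, $R_{\mathrm{h}}\in(0,\infty)$ (help rate, in nats). The message $m$ is uniformly distributed on $\mathcal{M}=\{0,1,\dots,e^{nR}-1\}$ and independent of $Z^n$; the encoder sends $x^n=\phi(m,T(z^n))\in\mathbb{R}^n$, subject to the power constraint $\sum_{i=1}^n \mathbb{E}\{([\phi(m,T(Z^n))]_i)^2\}\le nP$, the expectation being over both $m$ and $Z^n$. The decoder $\psi:\mathbb{R}^n\to\mathcal{M}$ outputs $\hat m=\psi(y^n)$, and the error probability is $P_{\mathrm{e}}(\phi,\psi,T)=\Pr\{\psi(\phi(m,T(Z^n))+Z^n)\neq m\}$. The reliability function is $$E(R)=\limsup_{n\to\infty}\left\{-\frac{1}{n}\log\Big[\inf_{\phi,\psi,T}P_{\mathrm{e}}(\phi,\psi,T)\Big]\right\},$$ the infimum being over all rate-$R$ encoders, their decoders, and rate-$R_{\mathrm{h}}$ helpers. Let $C_0=\frac12\log(1+P/\sigma^2)$ and let $E_{\mathrm{a}}(\cdot)$ be any achievable error exponent function for the same AWGN channel with power $P$ and without help. Then $$E(R)\ge\begin{cases}\infty & R<R_{\mathrm{h}},\\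 E_{\mathrm{a}}(R-R_{\mathrm{h}}) & R_{\mathrm{h}}<R<R_{\mathrm{h}}+C_0,\\ 0 & R\ge R_{\mathrm{h}}+C_0,\end{cases}$$ where the assertion $E(R)\ge\infty$ for $R<R_{\mathrm{h}}$ means that an arbitrarily large error exponent is achievable (i.e., for every $B<\infty$ there exist such schemes whose error probability decays with exponent at least $B$).
   Context: Logarithms are natural (rates in nats per channel use). ''An achievable error exponent function $E_{\mathrm{a}}(\cdot)$ for the AWGN channel without help'' means a function such that, for each rate $r$, there exist ordinary channel codes (encoder depending only on the message, satisfying the same power constraint $P$) of rate $r$ and decoders whose error probability over $\mathcal{N}(0,\sigma^2)$ i.i.d. noise is at most $e^{-n[E_{\mathrm{a}}(r)-o(1)]}$ as $n\to\infty$ (examples: the random coding exponent or the expurgated exponent of the AWGN channel). *)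

(* Defs.v *)
From HB Require Import structures.
From mathcomp Require Import all_boot all_order all_algebra.
From mathcomp Require Import all_classical all_reals all_analysis.
Set Implicit Arguments.
Unset Strict Implicit.
Unset Printing Implicit Defensive.
Import Order.TTheory GRing.Theory Num.Theory.
Import numFieldNormedType.Exports.
Local Open Scope classical_set_scope.
Local Open Scope ring_scope.

Section awgn.
Variable R : realType.

(** Expectation over Z^n i.i.d. N(0, sigma2), written as the iterated
    (Tonelli) integral w.r.t. the one-dimensional law N(0, sigma2)
    (normal_prob takes the standard deviation). *)
Fixpoint iid_gauss_int (sigma2 : R) (n : nat) :
    (n.-tuple R -> \bar R) -> \bar R :=
  match n with
  | 0 => fun f => f [tuple]
  | k.+1 => fun f =>
      (\int[normal_prob 0 (Num.sqrt sigma2)]_x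
          iid_gauss_int sigma2 (fun t : k.-tuple R => f [tuple of x :: t]))%E
  end.

Definition tadd (n : nat) (x z : n.-tuple R) : n.-tuple R :=
  [tuple tnth x i + tnth z i | i < n].

Definition expect_mZ (sigma2 : R) (n M : nat)
    (g : 'I_M -> n.-tuple R -> \bar R) : \bar R :=
  ((M%:R)^-1)%:E * \sum_(m < M) iid_gauss_int sigma2 (g m).

Definition msize (n : nat) (r : R) : nat :=
  `|Num.ceil (expR (n%:R * r))|%N.
Definition hsize (n : nat) (rh : R) : nat :=
  `|Num.floor (expR (n%:R * rh))|%N.

Definition helped_power_ok (P sigma2 : R) (n M K : nat)
    (phi : 'I_M -> 'I_K -> n.-tuple R) (T : n.-tuple R -> 'I_K) : Prop :=
  (\sum_(i < n) expect_mZ sigma2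
       (fun m z => ((tnth (phi m (T z)) i) ^+ 2)%:E)
   <= (n%:R * P)%:E)%E.

Definition helped_Pe (sigma2 : R) (n M K : nat)
    (phi : 'I_M -> 'I_K -> n.-tuple R) (psi : n.-tuple R -> 'I_M)
    (T : n.-tuple R -> 'I_K) : \bar R :=
  expect_mZ sigma2
    (fun m z => (\1_[set z' | psi (tadd (phi m (T z')) z') != m] z)%:E).

Definition helped_scheme_ok (P sigma2 : R) (n M K : nat)
    (phi : 'I_M -> 'I_K -> n.-tuple R) (psi : n.-tuple R -> 'I_M)
    (T : n.-tuple R -> 'I_K) : Prop :=
  (forall t, measurable (T @^-1` [set t])) /\
  (forall m, measurable (psi @^-1` [set m])) /\
  helped_power_ok P sigma2 phi T.

Definition helped_Pe_inf (P sigma2 rh r : R) (n : nat) : \bar R :=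
  ereal_inf [set p | exists (phi : 'I_(msize n r) -> 'I_(hsize n rh) -> n.-tuple R)
                            (psi : n.-tuple R -> 'I_(msize n r))
                            (T : n.-tuple R -> 'I_(hsize n rh)),
                 helped_scheme_ok P sigma2 phi psi T /\
                 p = helped_Pe sigma2 phi psi T].

Definition neg_log_rate (n : nat) (p : \bar R) : \bar R :=
  if p == 0%E then +oo%E else (- ((n%:R)^-1 * ln (fine p))%:E)%E.

Definition reliability (P sigma2 rh r : R) : \bar R :=
  limn_esup (fun n => neg_log_rate n (helped_Pe_inf P sigma2 rh r n)).

Definition code_power_ok (P sigma2 : R) (n M : nat)
    (f : 'I_M -> n.-tuple R) : Prop :=
  (\sum_(i < n) expect_mZ sigma2 (fun m (z : n.-tuple R) => ((tnth (f m) i) ^+ 2)%:E)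
   <= (n%:R * P)%:E)%E.

Definition code_Pe (sigma2 : R) (n M : nat)
    (f : 'I_M -> n.-tuple R) (psi : n.-tuple R -> 'I_M) : \bar R :=
  expect_mZ sigma2
    (fun m z => (\1_[set z' | psi (tadd (f m) z') != m] z)%:E).

Definition achievable_exponent (P sigma2 : R) (Ea : R -> R) : Prop :=
  forall r : R, forall eps : R, 0 < eps ->
    \forall n \near \oo,
      exists (f : 'I_(msize n r) -> n.-tuple R)
             (psi : n.-tuple R -> 'I_(msize n r)),
        (forall m, measurable (psi @^-1` [set m])) /\
        code_power_ok P sigma2 f /\
        (code_Pe sigma2 f psi <= (expR (- (n%:R * (Ea r - eps))))%:E)%E.

Definition capacity (P sigma2 : R) : R := 2^-1 * ln (1 + P / sigma2).

End awgn.

(* Main.v *)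
Require Import Defs.
From HB Require Import structures.
From mathcomp Require Import all_boot all_order all_algebra.
From mathcomp Require Import all_classical all_reals all_analysis measurable_realfun.
From mathcomp Require Import ring lra.
Import Order.TTheory GRing.Theory Num.Theory.
Local Open Scope ring_scope.

(** One coordinate carries all the help. The helper quantizes the noise [z] of
    that coordinate with [K] cells and the encoder moves the output into the
    cell labelled by its message, so that [L K] messages go through without
    error as long as [|z| < A], where [A] is of order [sqrt n]; this fails with
    probability [exp (- n B)] for any prescribed [B]. Half of the cells are
    spent on [|z| < a] for a constant [a]: the large amplitudes, of order [A],
    are then used so rarely that the mean power stays below [q n] for any
    prescribed [q > 0]. For [r < Rh] this already suffices.

    For [r > Rh] the other [n - 1] coordinates carry a code without help of
    rate [r - Rh]. The power spent on the first coordinate is recovered from the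
    code: after discarding a constant fraction of the codewords, the remaining
    ones have nearly minimal energy and error; they are sent scaled by
    [1 - eta], and the decoder is applied to the output divided by [1 + eta].
    The density of the rescaled output exceeds that of the original one by a
    factor at most [exp (O (eta n))], so that the exponent loss vanishes with
    [eta]. The constant factor of lost codewords is compensated by [L]. *)

(** * Gaussian measures on the line *)

Section gauss1.
Local Open Scope classical_set_scope.
Context {R : realType}.
Notation lebesgue := (@lebesgue_measure R).

(** Needed because the iterated integrals below are taken of arbitrary integrands. The integral of a
    nonnegative function is a supremum over nonnegative simple functions below it, which is
    monotone. *)
Lemma ge0_le_integral_nomeas d (T : measurableType d)
    (mu : {measure set T -> \bar R}) (f g : T -> \bar R) :
  (forall x, 0 <= f x)%E -> (forall x, f x <= g x)%E ->
  (\int[mu]_x f x <= \int[mu]_x g x)%E.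
Proof.
move=> f0 fg; rewrite !ge0_integralTE//; last by move=> x; exact: le_trans (fg x).
apply: le_ereal_sup => _ [h hf <-]; exists h => // x.
exact: le_trans (hf x) (fg x).
Qed.

Lemma measurable_affine (s b : R) :
  measurable_fun [set: measurableTypeR R]
    ((fun z : R => (z + b) / s) : measurableTypeR R -> measurableTypeR R).
Proof. by apply: measurable_funM => //; exact: measurable_funD. Qed.

(** The pushforward divided by [s] gives each half-open interval its length, so it is Lebesgue
    measure by uniqueness. *)
Lemma lebesgue_measure_affine (s b : R) (A : set R) : 0 < s -> measurable A ->
  lebesgue ((fun z => (z + b) / s) @^-1` A) = (s%:E * lebesgue A)%E.
Proof.
move=> s0 mA; have si0 : 0 <= s^-1 by rewrite invr_ge0 ltW.
have maff := measurable_affine s b.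
pose pf := measure_function_pushforward__canonical__measure_function_Measure lebesgue maff.
pose nu : {measure set (measurableTypeR R) -> \bar R} := mscale (NngNum si0) pf.
rewrite (@lebesgue_measure_unique R nu _ A)//; last first.
  move=> _ [[x y] _ <-].
  have -> : nu `]x, y] = (s^-1%:E * lebesgue `](s * x - b)%R, (s * y - b)%R])%E.
    rewrite /nu/= /mscale/= /pushforward; congr (_ * lebesgue _)%E.
    apply/seteqP; split => z /=; rewrite !in_itv/= ltr_pdivlMr// ler_pdivrMr//;
      rewrite ltrBlDr lerBrDr ![s * _]mulrC//.
  rewrite !lebesgue_measure_itv/= !lte_fin ltrD2r ltr_pM2l//.
  case: ifP => _; last by rewrite mule0.
  rewrite -EFinM; congr (_%:E); field; exact: lt0r_neq0.
rewrite /nu/= /mscale/= muleA -EFinM divff ?mul1e//; exact: lt0r_neq0.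
Qed.

(** Change of variables; it lets two affine images of the same noise be compared through their
    densities. *)
Lemma normal_prob_affine (sd s b : R) (A : set R) : 0 < s -> measurable A ->
  normal_prob 0 sd ((fun z => (z + b) / s) @^-1` A) =
  (\int[lebesgue]_(y in A) (s * normal_pdf 0 sd (s * y - b))%:E)%E.
Proof.
move=> s0 mA; rewrite /normal_prob.
have maff := measurable_affine s b.
have mpdf : measurable_fun [set: R] (fun y => (normal_pdf 0 sd (s * y - b))%:E).
  apply/measurable_EFinP/measurableT_comp; first exact: measurable_normal_pdf.
  by apply: measurable_funB => //; exact: measurable_funM.
pose pf := measure_function_pushforward__canonical__measure_function_Measure lebesgue maff.
transitivity (\int[pf]_(y in A) (normal_pdf 0 sd (s * y - b))%:E)%E.
  rewrite ge0_integral_pushforward//; last 2 first.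
  - exact: measurable_funTS.
  - by move=> y _; rewrite lee_fin normal_pdf_ge0.
  apply: eq_integral => z _ /=; congr (normal_pdf _ _ _)%:E.
  by field; exact: lt0r_neq0.
rewrite (eq_measure_integral (mscale (NngNum (ltW s0)) lebesgue)); last first.
  by move=> B mB _; rewrite /= /mscale/= /pushforward lebesgue_measure_affine.
rewrite ge0_integral_mscale//=; last 2 first.
- exact: measurable_funTS.
- by move=> y _; rewrite lee_fin normal_pdf_ge0.
under [RHS]eq_integral do rewrite EFinM.
rewrite ge0_integralZl//.
- exact: measurable_funTS.
- by move=> y _; rewrite lee_fin normal_pdf_ge0.
- by rewrite lee_fin ltW.
Qed.

Lemma normal_pdfE0 (sd x : R) : 0 < sd ->
  normal_pdf 0 sd x = normal_peak sd * expR (- x ^+ 2 / (sd ^+ 2 *+ 2)).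
Proof. by move=> /gt_eqF sd0; rewrite /normal_pdf sd0 /normal_fun subr0. Qed.

(* Contracting the signal by [1 - eta] and the output by [1 + eta] makes the
   ratio of the two output densities bounded, because the variance shrinks. *)
Lemma normal_pdf_shrink (sd eta c y : R) : 0 < sd -> 0 < eta -> eta <= 1 ->
  (1 + eta) * normal_pdf 0 sd ((1 + eta) * y - (1 - eta) * c) <=
  expR (eta * (1 + c ^+ 2 / sd ^+ 2)) * normal_pdf 0 sd (1 * y - c).
Proof.
move=> sd0 e0 e1; rewrite !normal_pdfE0// mulrCA [leRHS]mulrCA.
rewrite ler_wpM2l ?normal_peak_ge0// mulrDr mulr1 expRD -mulrA -expRD.
(* The Jacobian [1 + eta] is absorbed by [expR eta]; what remains compares two exponents. *)
apply: ler_pM; rewrite ?expR_ge0//; first lra.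
  by apply: le_trans (expR_ge1Dx _).
rewrite ler_expR -subr_ge0.
have sd2 : 0 < sd ^+ 2 by rewrite exprn_gt0.
rewrite [X in 0 <= X](_ : _ = ((eta * c ^+ 2) *+ 2 - (1 * y - c) ^+ 2 +
  ((1 + eta) * y - (1 - eta) * c) ^+ 2) / (sd ^+ 2 *+ 2)); last first.
  by field; exact: lt0r_neq0.
rewrite divr_ge0 ?mulrn_wge0 ?(ltW sd2)//.
(* Over the common denominator, the difference of the exponents is a nonnegative combination of
   squares. *)
suff -> : (eta * c ^+ 2) *+ 2 - (1 * y - c) ^+ 2 +
  ((1 + eta) * y - (1 - eta) * c) ^+ 2 =
  eta * (eta * (y + c) ^+ 2 + 2 * y ^+ 2) by
  rewrite mulr_ge0 ?(ltW e0)// addr_ge0// mulr_ge0 ?sqr_ge0// ltW.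
ring.
Qed.

(** The pointwise bound on densities makes the first output law at most a multiple of the second on
    every measurable set, hence also for integrals. *)
Lemma normal_integral_shrink (sd eta c : R) (u : R -> \bar R) :
  0 < sd -> 0 < eta -> eta <= 1 ->
  measurable_fun [set: R] u -> (forall x, 0 <= u x)%E ->
  (\int[normal_prob 0 sd]_z u (((1 - eta) * c + z) / (1 + eta))%R <=
   (expR (eta * (1 + c ^+ 2 / sd ^+ 2))%R)%:E *
   \int[normal_prob 0 sd]_z u (c + z)%R)%E.
Proof.
move=> sd0 e0 e1 mu u0; set C := expR _.
have C0 : 0 <= C by exact: expR_ge0.
have m1 := measurable_affine (1 + eta) ((1 - eta) * c).
have m2 := measurable_affine 1 c.
pose p1 := measure_function_pushforward__canonical__measure_function_Measure (normal_prob 0 sd) m1.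
pose p2 : {measure set (measurableTypeR R) -> \bar R} := mscale (NngNum C0)
  (measure_function_pushforward__canonical__measure_function_Measure (normal_prob 0 sd) m2).
have -> : (\int[normal_prob 0 sd]_z u (((1 - eta) * c + z) / (1 + eta))%R =
    \int[p1]_y u y)%E.
  rewrite ge0_integral_pushforward//= preimage_setT.
  by apply: eq_integral => z _ /=; rewrite addrC.
have -> : (C%:E * \int[normal_prob 0 sd]_z u (c + z)%R = \int[p2]_y u y)%E.
  rewrite ge0_integral_mscale// ge0_integral_pushforward//= preimage_setT.
  by congr (_ * _)%E; apply: eq_integral => z _ /=; rewrite addrC divr1.
apply: ge0_le_measure_integral => // A mA.
rewrite /p1 /p2 /= /mscale/= /pushforward !normal_prob_affine//; last lra.
have mpdf (s b : R) : measurable_fun A (fun y => (s * normal_pdf 0 sd (s * y - b))%:E).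
  apply/measurable_EFinP/measurable_funTS/measurable_funM => //.
  apply/measurableT_comp; first exact: measurable_normal_pdf.
  by apply: measurable_funB => //; exact: measurable_funM.
rewrite -ge0_integralZl//; last by move=> y _; rewrite lee_fin mul1r normal_pdf_ge0.
apply: ge0_le_integral => //.
- by move=> y _; rewrite lee_fin mulr_ge0 ?normal_pdf_ge0//; lra.
- exact: measurable_funeM.
- by move=> y _; rewrite -EFinM lee_fin mul1r; exact: normal_pdf_shrink.
Qed.

Lemma measurable_norm_ge (a : R) : measurable [set z : R | a <= `|z|].
Proof.
rewrite -[X in measurable X]setTI.
have -> : [set z : R | a <= `|z|] = Num.norm @^-1` `[a, +oo[.
  by apply/seteqP; split => z /=; rewrite in_itv/= andbT.
exact: normr_measurable.
Qed.

(** Half of the Gaussian exponent is bounded by its value at [a]; the other half is, up to a factor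
    [Num.sqrt 2], the density of variance [2 sd^2], whose total mass is 1. *)
Lemma normal_tail (sd a : R) : 0 < sd -> 0 <= a ->
  (normal_prob 0 sd [set z : R | (a <= `|z|)%R] <=
   (2 * expR (- (a ^+ 2 / (sd ^+ 2 *+ 4))))%R%:E)%E.
Proof.
move=> sd0 a0; pose sd2 := Num.sqrt 2 * sd.
have q0 : 0 < Num.sqrt 2 :> R by rewrite sqrtr_gt0.
have q2 : Num.sqrt 2 ^+ 2 = 2 :> R by rewrite sqr_sqrtr.
have sd20 : 0 < sd2 by rewrite mulr_gt0.
set A := [set z : R | a <= `|z|].
have mA : measurable A by exact: measurable_norm_ge.
set K := 2 * _.
have K0 : 0 <= K by rewrite mulr_ge0 ?expR_ge0.
have mpdf (s : R) (D : set R) : measurable_fun D (fun y => (normal_pdf 0 s y)%:E).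
  by apply/measurable_EFinP/measurable_funTS; exact: measurable_normal_pdf.
apply: (@le_trans _ _ (\int[lebesgue]_y (K * normal_pdf 0 sd2 y)%:E)%E); last first.
  under eq_integral do rewrite EFinM.
  rewrite ge0_integralZl//; last 2 first.
  - exact: mpdf.
  - by move=> y _; rewrite lee_fin normal_pdf_ge0.
  by rewrite integral_normal_pdf mule1.
apply: (@le_trans _ _ (\int[lebesgue]_(y in A)
    (K * normal_pdf 0 sd2 y)%:E)%E); last first.
  apply: ge0_subset_integral => //.
    by apply/measurable_EFinP/measurable_funM => //; exact: measurable_normal_pdf.
  by move=> y _; rewrite lee_fin mulr_ge0 ?normal_pdf_ge0.
apply: ge0_le_integral => //.
- by move=> y _; rewrite lee_fin normal_pdf_ge0.
- exact: mpdf.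
- apply/measurable_EFinP/measurable_funM => //.
  by apply/measurable_funTS; exact: measurable_normal_pdf.
move=> y /= ay; rewrite lee_fin !normal_pdfE0// /K.
have -> : normal_peak sd2 = (Num.sqrt 2)^-1 * normal_peak sd :> R.
  rewrite /normal_peak /sd2 exprMn q2.
  rewrite -!mulrnAr -[2 * _ * _]mulrA sqrtrM// invfM.
  by [].
have sqn0 : (Num.sqrt 2 : R) != 0 by rewrite gt_eqF.
have e1 : expR (- y ^+ 2 / (sd ^+ 2 *+ 2)) =
    expR (- (y ^+ 2 / (sd ^+ 2 *+ 4))) * expR (- y ^+ 2 / (sd2 ^+ 2 *+ 2)) :> R.
  by rewrite -expRD /sd2 exprMn q2; congr expR; field; rewrite gt_eqF.
have e2 : expR (- (y ^+ 2 / (sd ^+ 2 *+ 4))) <= expR (- (a ^+ 2 / (sd ^+ 2 *+ 4))).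
  rewrite ler_expR lerN2 ler_pM2r ?invr_gt0 ?mulrn_wgt0 ?exprn_gt0//.
  by rewrite -(real_normK (num_real y)) lerXn2r ?nnegrE.
have s1 : 1 <= 2 * (Num.sqrt 2)^-1 :> R.
  have r1 : 1 <= Num.sqrt 2 :> R by rewrite -[leLHS]sqrtr1 ler_sqrt// ler1n.
  rewrite ler_pdivlMr// mul1r -[leRHS]q2 expr2; exact: (ler_peMl (ltW q0)).
rewrite e1; set X := expR (- (y ^+ 2 / _)) in e2 *; set Y := expR (- (a ^+ 2 / _)) in e2 *.
set Z := expR _; set p := normal_peak sd.
have p0 : 0 <= p * Z by rewrite mulr_ge0 ?normal_peak_ge0 ?expR_ge0.
rewrite [leRHS](_ : _ = (2 * (Num.sqrt 2)^-1) * (Y * (p * Z))); last by ring.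
rewrite [leLHS](_ : _ = 1 * (X * (p * Z))); last by ring.
by apply: ler_pM => //; [rewrite mulr_ge0 ?expR_ge0|exact: ler_wpM2r].
Qed.
End gauss1.

(** * Iterated Gaussian integrals *)

Section iid_gauss.
Local Open Scope classical_set_scope.
Context {R : realType} (sigma2 : R).

Lemma iid_gauss_intS n (f : n.+1.-tuple R -> \bar R) :
  iid_gauss_int sigma2 f = (\int[normal_prob 0 (Num.sqrt sigma2)]_x
    iid_gauss_int sigma2 (fun t : n.-tuple R => f [tuple of x :: t]))%E.
Proof. by []. Qed.

Lemma iid_gauss_int_ge0 n (f : n.-tuple R -> \bar R) :
  (forall z, 0 <= f z)%E -> (0 <= iid_gauss_int sigma2 f)%E.
Proof.
elim: n f => [|n IH] f f0 /=; first exact: f0.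
by apply: integral_ge0 => x _; apply: IH => t; exact: f0.
Qed.

Lemma iid_gauss_int_le n (f g : n.-tuple R -> \bar R) :
  (forall z, 0 <= f z)%E -> (forall z, f z <= g z)%E ->
  (iid_gauss_int sigma2 f <= iid_gauss_int sigma2 g)%E.
Proof.
elim: n f g => [|n IH] f g f0 fg /=; first exact: fg.
apply: ge0_le_integral_nomeas => x; last by apply: IH => t.
by apply: iid_gauss_int_ge0 => t; exact: f0.
Qed.

Lemma iid_gauss_int_cst n (c : \bar R) :
  iid_gauss_int sigma2 (fun _ : n.-tuple R => c) = c.
Proof.
elim: n => [|n IH]//; rewrite iid_gauss_intS; under eq_integral do rewrite IH.
rewrite integral_cst// [X in (_ * X)%E](_ : _ = 1%E) ?mule1//.
exact: (@probability_setT _ _ _ (normal_prob 0 (Num.sqrt sigma2))).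
Qed.

(** The parameter space is arbitrary so that the induction can move the outermost noise coordinate
    into it; Tonelli then integrates that coordinate out. *)
Lemma measurable_iid_gauss_int n d (T : measurableType d)
    (f : T -> n.-tuple R -> \bar R) :
  measurable_fun [set: T * n.-tuple R] (fun p => f p.1 p.2) ->
  (forall t z, 0 <= f t z)%E ->
  measurable_fun [set: T] (fun t => iid_gauss_int sigma2 (f t)).
Proof.
elim: n d T f => [|n IH] d T f mf f0 /=.
  apply: (@measurableT_comp _ _ _ _ _ _ (fun p => f p.1 p.2) _
    (fun t : T => (t, [tuple] : 0.-tuple R))) => //.
have := @measurable_fun_fubini_tonelli_F _ _ T (measurableTypeR R) R
  (normal_prob 0 (Num.sqrt sigma2))
  (fun p : T * R => iid_gauss_int sigma2 (fun s : n.-tuple R => f p.1 [tuple of p.2 :: s])).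
apply.
- apply: (IH _ (T * measurableTypeR R)%type) => //.
  apply: (@measurableT_comp _ _ _ _ _ _ (fun p => f p.1 p.2) _
    (fun q : (T * R) * n.-tuple R => (q.1.1, [tuple of q.1.2 :: q.2]))) => //.
  apply: measurable_fun_pair; first exact: measurableT_comp.
  by apply: measurable_cons => //; exact: measurableT_comp.
- by move=> p; apply: iid_gauss_int_ge0 => z; exact: f0.
Qed.

Lemma iid_gauss_int_head n (u : R -> \bar R) :
  iid_gauss_int sigma2 (fun z : n.+1.-tuple R => u (thead z)) =
  (\int[normal_prob 0 (Num.sqrt sigma2)]_x u x)%E.
Proof.
rewrite iid_gauss_intS; apply: eq_integral => x _.
rewrite -[RHS](@iid_gauss_int_cst n); congr (iid_gauss_int _ _).
Qed.

(** The channel output for the contracted codeword [(1 - eta) c], after division by [1 + eta]. *)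
Definition tshrink (eta : R) {n} (c z : n.-tuple R) : n.-tuple R :=
  [tuple ((1 - eta) * tnth c i + tnth z i) / (1 + eta) | i < n].

Lemma cons_mktuple {T : Type} n (F : 'I_n.+1 -> T) :
  [tuple F i | i < n.+1] = [tuple of F ord0 :: [tuple F (lift ord0 i) | i < n]].
Proof.
apply: eq_from_tnth => i; rewrite tnth_mktuple.
by case: (unliftP ord0 i) => [j ->|->]; rewrite ?tnthS ?tnth_mktuple// tnth0.
Qed.

Lemma tnth_cons_lift {T : Type} n (x : T) (t : n.-tuple T) i :
  tnth [tuple of x :: t] (lift ord0 i) = tnth t i.
Proof. exact: tnthS. Qed.

Lemma measurable_tadd n (c : n.-tuple R) :
  measurable_fun [set: n.-tuple R] (tadd c).
Proof.
apply/measurable_fun_tnthP => i.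
under [X in measurable_fun _ X]eq_fun do rewrite /= tnth_mktuple.
by apply: measurable_funD => //; exact: measurable_tnth.
Qed.

(** The one-dimensional bound is applied coordinate by coordinate. The factors multiply, so the
    exponents add up to [n] plus the energy of [c] over [sigma2]. *)
Lemma iid_gauss_int_shrink (eta : R) {n} (c : n.-tuple R) (h : n.-tuple R -> \bar R) :
  0 < sigma2 -> 0 < eta -> eta <= 1 ->
  measurable_fun [set: n.-tuple R] h -> (forall z, 0 <= h z)%E ->
  (iid_gauss_int sigma2 (fun z => h (tshrink eta c z)) <=
   (expR (eta * (n%:R + (\sum_i tnth c i ^+ 2) / sigma2)))%R%:E *
   iid_gauss_int sigma2 (fun z => h (tadd c z)))%E.
Proof.
move=> s0 e0 e1; elim: n c h => [|n IH] c h mh h0.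
  rewrite big_ord0 mul0r addr0 mulr0 expR0 mul1e /=.
  by rewrite (tuple0 (tshrink _ _ _)) (tuple0 (tadd _ _)).
have sd0 : 0 < Num.sqrt sigma2 by rewrite sqrtr_gt0.
have sd2 : Num.sqrt sigma2 ^+ 2 = sigma2 by rewrite sqr_sqrtr// ltW.
pose c0 := thead c; pose c' : n.-tuple R := [tuple of behead c].
have ec : c = [tuple of c0 :: c'] by exact: tuple_eta.
have shE (x : R) (t : n.-tuple R) : tshrink eta c [tuple of x :: t] =
    [tuple of ((1 - eta) * c0 + x) / (1 + eta) :: tshrink eta c' t].
  rewrite ec /tshrink cons_mktuple !tnth0.
  congr [tuple of _ :: _]; apply: eq_from_tnth => i.
  by rewrite !tnth_mktuple !tnth_cons_lift.
have adE (x : R) (t : n.-tuple R) : tadd c [tuple of x :: t] = [tuple of c0 + x :: tadd c' t].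
  rewrite ec /tadd cons_mktuple !tnth0.
  congr [tuple of _ :: _]; apply: eq_from_tnth => i.
  by rewrite !tnth_mktuple !tnth_cons_lift.
pose C' := expR (eta * (n%:R + (\sum_i tnth c' i ^+ 2) / sigma2)).
pose C0 := expR (eta * (1 + c0 ^+ 2 / sigma2)).
have -> : expR (eta * (n.+1%:R + (\sum_i tnth c i ^+ 2) / sigma2)) = C' * C0.
  rewrite -expRD; congr expR; rewrite {1}ec big_ord_recl tnth0.
  under eq_bigr do rewrite tnth_cons_lift.
  by rewrite -natr1; field; rewrite gt_eqF.
pose u (a : R) := iid_gauss_int sigma2 (fun t => h [tuple of a :: tadd c' t]).
have mhc : measurable_fun [set: measurableTypeR R * n.-tuple R]
    (fun p => h [tuple of p.1 :: tadd c' p.2]).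
  apply: (@measurableT_comp _ _ _ _ _ _ h) => //.
  apply: measurable_cons => //; apply: measurableT_comp => //; exact: measurable_tadd.
have mu : measurable_fun [set: measurableTypeR R] u.
  by apply: (@measurable_iid_gauss_int n _ (measurableTypeR R)
    (fun a t => h [tuple of a :: tadd c' t])).
have u0 a : (0 <= u a)%E by apply: iid_gauss_int_ge0 => t; exact: h0.
(* The last [n] coordinates are treated first, with the first noise value fixed; the one-dimensional
   bound for [u] then treats the first coordinate. *)
rewrite !iid_gauss_intS; apply: (@le_trans _ _ (\int[normal_prob 0 (Num.sqrt sigma2)]_x
    (C'%:E * u (((1 - eta) * c0 + x) / (1 + eta))%R))%E).
  apply: ge0_le_integral_nomeas => x.
    by apply: iid_gauss_int_ge0 => t; exact: h0.
  under [X in (iid_gauss_int _ X <= _)%E]eq_fun do rewrite shE.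
  apply: (IH c' (fun t => h [tuple of ((1 - eta) * c0 + x) / (1 + eta) :: t])) => //.
  by apply: measurableT_comp => //; exact: measurable_cons.
rewrite ge0_integralZl//; last 2 first.
- apply: (measurableT_comp mu).
  by under eq_fun do rewrite addrC; exact: measurable_affine.
- by rewrite lee_fin expR_ge0.
rewrite EFinM -muleA lee_wpmul2l// ?lee_fin ?expR_ge0//.
have := @normal_integral_shrink R _ eta c0 u sd0 e0 e1 mu u0.
rewrite sd2 -/C0 => /le_trans; apply.
rewrite lee_wpmul2l// ?lee_fin ?expR_ge0//.
apply: ge0_le_integral_nomeas => x; first exact: u0.
by under [X in (_ <= iid_gauss_int _ X)%E]eq_fun do rewrite adE.
Qed.

End iid_gauss.

(** * Quantizing one noise coordinate *)

Section countably_valued.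
Local Open Scope classical_set_scope.
Context {d} {T : measurableType d}.

(** Measurability of index-valued maps in the form required by [helped_scheme_ok], with no
    sigma-algebra on the index type. *)
Definition fibers_measurable {I : Type} (g : T -> I) :=
  forall i, measurable (g @^-1` [set i]).

(** A fibre of the composite is a union of fibres of [g], countable through the enumeration
    [unpickle]. *)
Lemma fibers_measurable_comp {I : countType} {J : Type} (F : I -> J) (g : T -> I) :
  fibers_measurable g -> fibers_measurable (F \o g).
Proof.
move=> mg j.
rewrite (_ : _ @^-1` _ = \bigcup_n
    (if unpickle n is Some i then (if `[< F i = j >] then g @^-1` [set i] else set0)
     else set0)); last first.
  apply/seteqP; split => [x /= Fx|x [n _]].
    exists (pickle (g x)) => //; rewrite pickleK; case: asboolP => //.
  by case: unpickle => // i; case: asboolP => // <- /= ->.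
apply: bigcup_measurable => n _; case: unpickle => // i.
by case: ifP.
Qed.

Lemma fibers_measurable_pair {I J : Type} (f : T -> I) (g : T -> J) :
  fibers_measurable f -> fibers_measurable g ->
  fibers_measurable (fun x => (f x, g x)).
Proof.
move=> mf mg [i j].
rewrite (_ : _ @^-1` _ = f @^-1` [set i] `&` g @^-1` [set j]).
  exact: measurableI.
by apply/seteqP; split => x /= [-> ->].
Qed.

Lemma fibers_measurable_lt {R : realType} (f : T -> R) (a : R) :
  measurable_fun [set: T] f -> fibers_measurable (fun x => f x < a).
Proof.
move=> mf b.
have m1 : measurable (f @^-1` [set y | y < a]).
  rewrite -[X in measurable X]setTI; apply: mf => //.
  have -> : [set y : R | y < a] = `]-oo, a[; last exact: measurable_itv.
  by apply/seteqP; split => z /=; rewrite in_itv.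
case: b.
  by rewrite (_ : _ @^-1` _ = f @^-1` [set y | y < a]).
rewrite (_ : _ @^-1` _ = ~` (f @^-1` [set y | y < a])); first exact: measurableC.
by apply/seteqP; split => z /=; case: (f z < a).
Qed.

Lemma fibers_measurable_truncn {R : realType} (f : T -> R) :
  measurable_fun [set: T] f -> fibers_measurable (fun x => Num.truncn (f x)).
Proof.
move=> mf k.
have mlt m : measurable [set x | f x < m%:R].
  by have := fibers_measurable_lt f m%:R mf true.
case: k => [|k].
  (* [Num.truncn] is 0 on negative reals, so the level 0 is a whole half-line. *)
  rewrite (_ : _ @^-1` _ = [set x | f x < 1%:R])//.
  apply/seteqP; split => x /=.
    by move=> E; rewrite -truncn_le_nat E.
  by rewrite -truncn_le_nat leqn0 => /eqP.
rewrite (_ : _ @^-1` _ = ~` [set x | f x < k.+1%:R] `&` [set x | f x < k.+2%:R]).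
  by apply: measurableI => //; exact: measurableC.
apply/seteqP; split => x /=.
  move=> E; split; last by rewrite -truncn_le_nat E.
  by rewrite -truncn_le_nat E ltnn.
move=> [/negP]; rewrite -!truncn_le_nat -ltnNge => h1 h2.
by apply/eqP; rewrite eqn_leq h2.
Qed.

Lemma fibers_measurable_fun {d'} {U : measurableType d'} (g : T -> U) {I : Type} (f : U -> I) :
  measurable_fun [set: T] g -> (forall i, measurable (f @^-1` [set i])) ->
  fibers_measurable (f \o g).
Proof. by move=> mg mf i; rewrite comp_preimage -[X in measurable X]setTI; exact: mg. Qed.
End countably_valued.

(** * A quantizer with two cell widths *)

Section quantizer.
Context {R : realType}.
Variables (a A : R) (H K K' : nat).
Hypotheses (a0 : 0 < a) (aA : a <= A) (H0 : (0 < H)%N) (HK : (2 * H <= K.+1)%N).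

Let D0 := 2 * a / H%:R.
Let D1 := 2 * A / H%:R.
Let D := K'.+1%:R * D0.

Let HR0 : 0 < H%:R :> R. Proof. by rewrite ltr0n. Qed.
Let A0 : 0 < A. Proof. exact: lt_le_trans aA. Qed.
Let D00 : 0 < D0. Proof. by rewrite divr_gt0// mulr_gt0. Qed.
Let D10 : 0 < D1. Proof. by rewrite divr_gt0// mulr_gt0. Qed.

(* [H] cells of width [D0] cover [|z| < a] and [H] cells of width [D1] cover
   [a <= |z| < A]; the outputs of the second shell are shifted by [D]. *)
Definition quant_cell (z : R) : 'I_K.+1 :=
  inord (if `|z| < a then Num.truncn ((z + a) / D0)
         else if `|z| < A then (H + Num.truncn ((z + A) / D1))%N else 0%N).

(** The input is the left end of output cell [m] minus the left end of noise cell [i], so the noise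
    completes it to a point of output cell [m]. The [K'.+1] narrow output cells fill the interval
    from 0 to [D], which lets the decoder recognize the shell. *)
Definition quant_enc (m : 'I_K'.+1) (i : 'I_K.+1) : R :=
  if (i < H)%N then m%:R * D0 - (i%:R * D0 - a)
  else D + m%:R * D1 - ((i - H)%:R * D1 - A).

Definition quant_dec (y : R) : 'I_K'.+1 :=
  inord (if y < D then Num.truncn (y / D0) else Num.truncn ((y - D) / D1)).

Let trunc_lt {b w z : R} : 0 < b -> w = 2 * b / H%:R -> `|z| < b ->
  [/\ (Num.truncn ((z + b) / w) < H)%N,
      (Num.truncn ((z + b) / w))%:R * w <= z + b &
      z + b < (Num.truncn ((z + b) / w)).+1%:R * w].
Proof.
move=> b0 wE; rewrite ltr_norml => /andP[zb1 zb2].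
have w0 : 0 < w by rewrite wE divr_gt0// mulr_gt0.
have p0 : 0 <= (z + b) / w by rewrite divr_ge0 ?(ltW w0)//; lra.
have /andP[t1 t2] := truncn_itv p0.
split.
- rewrite truncn_lt_nat// ltr_pdivrMr// wE mulrC divfK ?gt_eqF//; lra.
- by rewrite -ler_pdivlMr.
- by rewrite -ltr_pdivrMr.
Qed.

Lemma quant_correct m z : `|z| < A -> quant_dec (quant_enc m (quant_cell z) + z) = m.
Proof.
move=> zA; apply: val_inj; rewrite /quant_dec /quant_enc /quant_cell.
have mK : (m%:R + 1 <= K'.+1%:R :> R) by rewrite natr1 ler_nat.
(* Relative to the left end of its cell, the noise lies between 0 and the width [w]. *)
have fin (w u : R) (k : nat) : 0 < w -> k%:R * w <= u -> u < k.+1%:R * w ->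
    Num.truncn ((m%:R * w - k%:R * w + u) / w) = m.
  move=> w0 u1 u2; apply: truncn_def.
  by rewrite ler_pdivlMr// ltr_pdivrMr// -natr1 mulrDl; move: u2; rewrite -natr1; lra.
case: (boolP (`|z| < a)) => za.
  have [t1 t2 t3] := @trunc_lt a D0 _ a0 erefl za.
  rewrite inordK; last by apply: leq_trans HK; rewrite mul2n -addnn ltn_addr.
  rewrite t1; set t := Num.truncn _ in t1 t2 t3 *.
  have -> : m%:R * D0 - (t%:R * D0 - a) + z = m%:R * D0 - t%:R * D0 + (z + a) by ring.
  rewrite fin//.
  (* The output stays below the right end of narrow cell [m], hence below [D], and the decoder takes
     the right branch. *)
  case: ifPn => [_|/negP[]]; first by rewrite /= inordK.
  rewrite /D; apply: lt_le_trans (_ : (m%:R + 1) * D0 <= _); last by rewrite ler_pM2r.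
  by move: t3; rewrite -natr1; lra.
rewrite zA.
have [t1 t2 t3] := @trunc_lt A D1 _ A0 erefl zA.
rewrite inordK; last by apply: leq_trans HK; rewrite mul2n -addnn ltn_add2l.
rewrite ltnNge leq_addr/= addKn; set t := Num.truncn _ in t1 t2 t3 *.
have -> : D + m%:R * D1 - (t%:R * D1 - A) + z = D + (m%:R * D1 - t%:R * D1 + (z + A)) by ring.
rewrite [D + _]addrC addrK fin// ifN; first by rewrite /= inordK.
have : 0 <= m%:R * D1 by rewrite mulr_ge0// ltW.
rewrite -leNgt; lra.
Qed.

Variable l : R.
Hypothesis (K'H : K'.+1%:R <= l * H%:R).

Let mD (m : 'I_K'.+1) {b w : R} : 0 < b -> w = 2 * b / H%:R ->
  0 <= m%:R * w <= 2 * l * b /\ K'.+1%:R * w <= 2 * l * b.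
Proof.
move=> b0 wE; have w0 : 0 < w by rewrite wE divr_gt0// mulr_gt0.
have h : K'.+1%:R * w <= 2 * l * b.
  by rewrite wE mulrA ler_pdivrMr// [leRHS](_ : _ = l * H%:R * (2 * b)) ?ler_pM2r ?mulr_gt0//; ring.
split => //; apply/andP; split; first by rewrite mulr_ge0// ltW.
by apply: le_trans h; rewrite ler_pM2r// ler_nat ltnW.
Qed.

Let iD (i : nat) {b w : R} : 0 < b -> w = 2 * b / H%:R -> (i <= H)%N ->
  0 <= i%:R * w <= 2 * b.
Proof.
move=> b0 wE iH; have w0 : 0 < w by rewrite wE divr_gt0// mulr_gt0.
rewrite mulr_ge0 ?(ltW w0)//=.
by rewrite wE mulrA ler_pdivrMr// mulrC ler_pM2l ?mulr_gt0// ler_nat.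
Qed.

(** The output cells reach at most [2 l a], and the left end of a noise cell lies between [- a] and
    [a]. *)
Lemma quant_small m z : `|z| < a -> `|quant_enc m (quant_cell z)| <= (2 * l + 1) * a.
Proof.
move=> za; rewrite /quant_enc /quant_cell za.
have [t1 t2 t3] := @trunc_lt a D0 _ a0 erefl za.
rewrite inordK; last by apply: leq_trans HK; rewrite mul2n -addnn ltn_addr.
rewrite t1; set t := Num.truncn _ in t1 t2 t3 *.
have [/andP[? ?] _] := @mD m a D0 a0 erefl.
have /andP[? ?] := @iD t a D0 a0 erefl (ltnW t1).
rewrite ler_norml; apply/andP; split; move: (a0) (aA) (A0) => *; lra.
Qed.

(** On the wide shell the shift [D] adds at most [2 l a] to an output offset of at most [2 l A] and
    a noise offset of at most [A]. *)
Lemma quant_large m z : `|quant_enc m (quant_cell z)| <= (4 * l + 1) * A.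
Proof.
have l0 : 0 < l by rewrite -(pmulr_lgt0 _ HR0); apply: lt_le_trans K'H.
have la : l * a <= l * A by rewrite ler_pM2l.
have lA : 0 < l * A by exact: mulr_gt0.
have laA : (2 * l + 1) * a <= (4 * l + 1) * A.
  have := aA; have := A0; lra.
have [za|za] := ltP `|z| a.
  exact: le_trans (quant_small m z za) _.
rewrite /quant_enc /quant_cell ltNge za/=.
have [/andP[? ?] _] := @mD m a D0 a0 erefl.
have [/andP[? ?] _] := @mD m A D1 A0 erefl.
have [_ ?] : _ /\ D <= 2 * l * a := @mD m a D0 a0 erefl.
have ? : 0 <= D by rewrite mulr_ge0// ltW.
case: (boolP (`|z| < A)) => zA.
  have [t1 t2 t3] := @trunc_lt A D1 _ A0 erefl zA.
  rewrite inordK; last by apply: leq_trans HK; rewrite mul2n -addnn ltn_add2l.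
  rewrite ltnNge leq_addr/= addKn; set t := Num.truncn _ in t1 t2 t3 *.
  have /andP[? ?] := @iD t A D1 A0 erefl (ltnW t1).
  rewrite ler_norml; apply/andP; split; move: (a0) (aA) (A0) => *; lra.
(* Beyond [A] the cell defaults to 0, a narrow one, so the input remains bounded although decoding
   may fail. *)
rewrite inordK// H0 mul0r.
rewrite ler_norml; apply/andP; split; move: (a0) (aA) (A0) => *; lra.
Qed.

(** The cell is a function of two comparisons and two truncations, a countably valued tuple. *)
Lemma fibers_quant_cell : fibers_measurable quant_cell.
Proof.
have ma : measurable_fun [set: R] (fun z : R => `|z|) by exact: normr_measurable.
have m : fibers_measurable (fun z : R => ((`|z| < a, `|z| < A),
    (Num.truncn ((z + a) / D0), Num.truncn ((z + A) / D1)))).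
  apply: fibers_measurable_pair; apply: fibers_measurable_pair.
  - exact: fibers_measurable_lt.
  - exact: fibers_measurable_lt.
  - by apply: fibers_measurable_truncn; exact: measurable_affine.
  - by apply: fibers_measurable_truncn; exact: measurable_affine.
exact: (fibers_measurable_comp (fun p : (bool * bool) * (nat * nat) =>
  inord (if p.1.1 then p.2.1 else if p.1.2 then (H + p.2.2)%N else 0%N) : 'I_K.+1) _ m).
Qed.

Lemma fibers_quant_dec : fibers_measurable quant_dec.
Proof.
have m : fibers_measurable (fun y : R => (y < D,
    (Num.truncn (y / D0), Num.truncn ((y - D) / D1)))).
  apply: fibers_measurable_pair; first exact: fibers_measurable_lt.
  apply: fibers_measurable_pair; apply: fibers_measurable_truncn.
    by have := measurable_affine D0 0; under eq_fun do rewrite addr0.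
  exact: measurable_affine.
exact: (fibers_measurable_comp (fun p : bool * (nat * nat) =>
  inord (if p.1 then p.2.1 else p.2.2) : 'I_K'.+1) _ m).
Qed.
End quantizer.

(** Sharing the help values between two shells leaves each at least a third of them. *)
Lemma leq_triple_half (k : nat) : (1 < k)%N -> (k <= 3 * k./2)%N.
Proof.
move=> k1; rewrite -{1}[k]odd_double_half -mul2n (mulnDl 1 2) leq_add2r mul1n.
by rewrite (leq_trans (leq_b1 _))// half_gt0.
Qed.

(** * Error-free scalar transmission outside a rare noise event *)

Section scalar_scheme.
Local Open Scope classical_set_scope.
Context {R : realType} (sigma2 : R) (sigma2_gt0 : 0 < sigma2).
Notation gauss := (normal_prob 0 (Num.sqrt sigma2)).

(** The energy bound [q] holds for each message, so any subset of the messages may be used. The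
    exceptional event [E] depends on the noise alone. *)
Definition scalar_scheme (K K' : nat) (q p : R) : Prop :=
  exists (T : R -> 'I_K) (enc : 'I_K' -> 'I_K -> R) (dec : R -> 'I_K') (E : set R),
    [/\ fibers_measurable T, fibers_measurable dec,
       measurable E /\ (gauss E <= p%:E)%E,
       (forall m, \int[gauss]_z ((enc m (T z)) ^+ 2)%:E <= q%:E)%E &
       forall m z, ~ E z -> dec (enc m (T z) + z) = m].

Let tail (a : R) : 0 <= a ->
  (gauss [set z : R | (a <= `|z|)%R] <= (2 * expR (- (a ^+ 2 / (4 * sigma2))))%R%:E)%E.
Proof.
move=> a0; have sd0 : 0 < Num.sqrt sigma2 by rewrite sqrtr_gt0.
apply: le_trans (normal_tail _ a sd0 a0) _.
rewrite sqr_sqrtr ?(ltW sigma2_gt0)//.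
by rewrite [4 * sigma2](_ : _ = sigma2 *+ 4) ?lexx// mulr_natl.
Qed.

Let le_sqr (x y : R) : `|x| <= y -> x ^+ 2 <= y ^+ 2.
Proof.
move=> xy; rewrite -(real_normK (num_real x)) lerXn2r ?nnegrE//.
exact: le_trans xy.
Qed.

(** The energy is at most the small bound when [|z| < a]; the large bound is weighted by the tail
    probability at [a]. Errors occur only when [|z| >= A]. *)
Lemma quant_scheme (a A l : R) (K K' H : nat) :
  0 < a -> a <= A -> (0 < H)%N -> (2 * H <= K.+1)%N -> K'.+1%:R <= l * H%:R ->
  scalar_scheme K.+1 K'.+1
    (((2 * l + 1) * a) ^+ 2 +
     ((4 * l + 1) * A) ^+ 2 * (2 * expR (- (a ^+ 2 / (4 * sigma2)))))
    (2 * expR (- (A ^+ 2 / (4 * sigma2)))).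
Proof.
move=> a0 aA H0 HK K'H.
have A0 : 0 < A by exact: lt_le_trans aA.
exists (quant_cell a A H K), (quant_enc a A H K K'), (quant_dec a A H K'),
  [set z : R | A <= `|z|]; split.
- exact: fibers_quant_cell.
- exact: fibers_quant_dec.
- by split; [exact: measurable_norm_ge|exact: tail (ltW A0)].
- move=> m; set c1 := (_ * a) ^+ 2; set c2 := (_ * A) ^+ 2.
  have c10 : 0 <= c1 by exact: sqr_ge0.
  have c20 : 0 <= c2 by exact: sqr_ge0.
  pose B := [set z : R | a <= `|z|].
  have mB : measurable B by exact: measurable_norm_ge.
  apply: (@le_trans _ _ (\int[gauss]_z (c1%:E + c2%:E * (\1_B z)%:E))%E).
    apply: ge0_le_integral_nomeas => z; first by rewrite lee_fin sqr_ge0.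
    rewrite -EFinM -EFinD lee_fin indicE.
    case: (boolP (z \in B)) => [_|].
      rewrite mulr1; apply: (@le_trans _ _ c2); last by rewrite lerDr.
      by apply: le_sqr; exact: quant_large.
    rewrite notin_setE /B /= mulr0 addr0 => /negP; rewrite -ltNge => za.
    by apply: le_sqr; exact: quant_small.
  have m1 : measurable_fun [set: measurableTypeR R] (fun z => (\1_B z)%:E : \bar R).
    by apply/measurable_EFinP; exact: measurable_indic.
  rewrite ge0_integralD//; last 2 first.
  - by move=> z _; rewrite -EFinM lee_fin mulr_ge0.
  - exact: measurable_funeM.
  rewrite ge0_integralZl// integral_cst// integral_indic// setIT.
  rewrite [X in (c1%:E * X + _)%E](_ : _ = 1%E); last first.
    exact: (@probability_setT _ _ _ (normal_prob 0 (Num.sqrt sigma2))).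
  rewrite mule1 EFinD leeD2l// (EFinM c2) lee_wpmul2l ?lee_fin//.
  exact: tail (ltW a0).
- move=> m z /= /negP; rewrite -ltNge => zA; exact: quant_correct.
Qed.

Lemma scalar_scheme_exists (L : nat) (q B : R) : 0 < q -> 0 < B ->
  exists n0 : nat, forall n K K', (n0 <= n)%N -> (1 < K)%N ->
    (0 < K' <= L * K)%N ->
    scalar_scheme K K' (n%:R * q) (2 * expR (- (n%:R * B))).
Proof.
move=> q0 B0; pose l : R := 3 * L%:R.
(* The 3 in [l] pays for giving each shell half of the cells. Below, [C] is chosen so that the
   large-amplitude energy is [n C expR (- x)], and [x = 2 C / q] makes this at most [n q / 2]. *)
have l0 : 0 <= l by rewrite mulr_ge0.
pose C := (4 * l + 1) ^+ 2 * (4 * sigma2 * B) * 2.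
have C0 : 0 < C.
  by rewrite !mulr_gt0//; lra.
pose x := 2 * C / q.
have x0 : 0 < x by rewrite divr_gt0// mulr_gt0.
pose a := Num.sqrt (4 * sigma2 * x).
have s4 : 0 < 4 * sigma2 by rewrite mulr_gt0.
have a0 : 0 < a by rewrite sqrtr_gt0 mulr_gt0.
have a2 : a ^+ 2 = 4 * sigma2 * x by rewrite sqr_sqrtr// ltW// mulr_gt0.
(* The first term ensures [a <= A]; the second keeps the small-amplitude energy below [n q / 2]. *)
pose bnd := x / B + ((2 * l + 1) * a) ^+ 2 / (q / 2).
exists (Num.truncn bnd).+1 => n [//|K] [//|K'] n0n K1 /andP[_ K'L].
have nb : bnd <= n%:R.
  by apply: (le_trans (ltW (truncnS_gt _))); rewrite ler_nat.
have t1 : 0 <= x / B by rewrite divr_ge0// ltW.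
have t2 : 0 <= ((2 * l + 1) * a) ^+ 2 / (q / 2).
  by rewrite divr_ge0 ?sqr_ge0//; lra.
have nx : x <= n%:R * B by rewrite -ler_pdivrMr//; rewrite /bnd in nb; lra.
have na : ((2 * l + 1) * a) ^+ 2 <= n%:R * (q / 2).
  by rewrite -ler_pdivrMr; rewrite /bnd in nb; lra.
(* This makes the tail exponent at [A] equal to [n B]. *)
pose A := Num.sqrt (4 * sigma2 * (n%:R * B)).
have nB : 0 <= 4 * sigma2 * (n%:R * B) by rewrite mulr_ge0 ?mulr_ge0// ltW.
have A2 : A ^+ 2 = 4 * sigma2 * (n%:R * B) by rewrite sqr_sqrtr.
have aA : a <= A by rewrite ler_sqrt// ler_pM2l.
have H3 : (K.+1 <= 3 * (K.+1)./2)%N by exact: leq_triple_half.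
have K'H : K'.+1%:R <= l * (K.+1)./2%:R :> R.
  rewrite /l mulrAC -!natrM ler_nat (leq_trans K'L)// mulnC.
  by rewrite leq_mul2r H3 orbT.
have := quant_scheme a A l K K' _ a0 aA _ _ K'H.
rewrite half_gt0 K1 mul2n -{2}[K.+1]odd_double_half leq_addl => /(_ isT isT).
rewrite A2 [4 * sigma2 * _]mulrC mulfK ?gt_eqF//.
rewrite a2 [4 * sigma2 * _]mulrC mulfK ?gt_eqF//.
case=> T [enc [dec [E [mT mdec mE henc hdec]]]].
exists T, enc, dec, E; split => // m; apply: (le_trans (henc m)).
rewrite lee_fin [n%:R * q](_ : _ = n%:R * (q / 2) + n%:R * (q / 2)); last by field.
apply: lerD => //.
rewrite exprMn A2 [leLHS](_ : _ = n%:R * (C * expR (- x))); last first.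
  by rewrite /C; ring.
rewrite ler_wpM2l// expRN -[_^-1]mul1r mulrA mulr1 ler_pdivrMr ?expR_gt0//.
have := expR_ge1Dx x => ex.
apply: (@le_trans _ _ (q / 2 * x)).
  by rewrite /x le_eqVlt; apply/orP; left; apply/eqP; field; rewrite gt_eqF.
by rewrite ler_wpM2l//; lra.
Qed.
End scalar_scheme.

(** * Codes without help *)

Section max_code.
Local Open Scope classical_set_scope.
Context {R : realType} (sigma2 : R) (sigma2_gt0 : 0 < sigma2).

(** Energy and error are bounded for each codeword, since a uniform message need not induce a
    uniform codeword once the code is combined with the quantizer. *)
Definition max_code (n M : nat) (S p : R) : Prop :=
  exists (f : 'I_M -> n.-tuple R) (psi : n.-tuple R -> 'I_M),
    [/\ forall m, measurable (psi @^-1` [set m]),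
       forall m, \sum_(i < n) tnth (f m) i ^+ 2 <= S &
       forall m, (iid_gauss_int sigma2
         (fun z => (\1_[set z' | psi (tadd (f m) z') != m] z)%:E) <= p%:E)%E].

(** Fills the unhelped coordinates when the rate is below the help rate. *)
Lemma max_code_trivial (n : nat) : max_code n 1 0 0.
Proof.
exists (fun=> [tuple 0 | _ < n]), (fun=> ord0); split => m.
- rewrite (_ : _ @^-1` _ = setT) ?ord1; first exact: measurableT.
  by apply/seteqP; split => // z _.
- by rewrite big1// => i _; rewrite tnth_mktuple expr0n.
- under eq_fun => z do rewrite indicE memNset ?ord1//=.
  by rewrite iid_gauss_int_cst.
Qed.

Lemma indic_psi_ge0 n (A : set (n.-tuple R)) z : (0 <= (\1_A z)%:E :> \bar R)%E.
Proof. by rewrite lee_fin indicE. Qed.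

(** Trades error for energy: the change of measure is applied to the error indicator of the original
    decoder, now fed with the rescaled output. *)
Lemma max_code_shrink (n M : nat) (S p eta : R) : 0 < eta -> eta <= 1 ->
  max_code n M S p ->
  max_code n M ((1 - eta) ^+ 2 * S) (expR (eta * (n%:R + S / sigma2)) * p).
Proof.
move=> e0 e1 [f [psi [mpsi hS hp]]].
pose sc (y : n.-tuple R) := [tuple tnth y i / (1 + eta) | i < n].
have msc : measurable_fun [set: n.-tuple R] sc.
  apply/measurable_fun_tnthP => i.
  under [X in measurable_fun _ X]eq_fun do rewrite /= tnth_mktuple.
  by apply: measurable_funM => //; exact: measurable_tnth.
exists (fun m => [tuple (1 - eta) * tnth (f m) i | i < n]), (psi \o sc); split => m.
- exact: (fibers_measurable_fun sc psi msc mpsi).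
- under eq_bigr do rewrite tnth_mktuple exprMn.
  by rewrite -mulr_sumr ler_wpM2l// sqr_ge0.
pose h (y : n.-tuple R) : \bar R := (\1_[set y | psi y != m] y)%:E.
have mh : measurable_fun [set: n.-tuple R] h.
  apply/measurable_EFinP/measurable_indic.
  rewrite (_ : [set y | psi y != m] = ~` (psi @^-1` [set m])); first exact: measurableC.
  by apply/seteqP; split => y /=; [move=> /eqP|move=> ?; exact/eqP].
have := @iid_gauss_int_shrink R sigma2 eta n (f m) h sigma2_gt0 e0 e1 mh
  (fun z => indic_psi_ge0 _ _ z).
have -> : (fun z => h (tshrink eta (f m) z)) = (fun z =>
    (\1_[set z' | psi (sc (tadd [tuple (1 - eta) * tnth (f m) i | i < n] z')) != m] z)%:E).
  apply/funext => z; rewrite /h !indicE !mem_setE/=.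
  congr (psi _ != m)%:R%:E; apply: eq_from_tnth => i.
  by rewrite !tnth_mktuple.
move=> /le_trans; apply.
have -> : (fun z => h (tadd (f m) z)) = (fun z =>
    (\1_[set z' | psi (tadd (f m) z') != m] z)%:E).
  by apply/funext => z; rewrite /h !indicE !mem_setE.
rewrite EFinM; apply: lee_pmul => //.
- by apply: iid_gauss_int_ge0 => z; exact: indic_psi_ge0.
- by rewrite lee_fin ler_expR ler_pM2l// lerD2l ler_pM2r ?invr_gt0.
Qed.

(* Markov's inequality for the single weight [energy / (n P) + kappa error / p]. *)
Lemma max_code_expurgate (n M : nat) (P p kappa : R)
    (f : 'I_M -> n.-tuple R) (psi : n.-tuple R -> 'I_M) :
  0 < P -> 0 < p -> 0 < kappa -> (0 < n)%N -> (0 < M)%N ->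
  (forall m, measurable (psi @^-1` [set m])) ->
  code_power_ok P sigma2 f -> (code_Pe sigma2 f psi <= p%:E)%E ->
  exists M' : nat, kappa * M%:R <= (1 + 2 * kappa) * M'%:R /\
    max_code n M' ((1 + 2 * kappa) * (n%:R * P)) ((1 + 2 * kappa) / kappa * p).
Proof.
move=> P0 p0 k0 n0 M0 mpsi hpow herr.
have MR0 : 0 < M%:R :> R by rewrite ltr0n.
have nP0 : 0 < n%:R * P by rewrite mulr_gt0 ?ltr0n.
pose S m := \sum_(i < n) tnth (f m) i ^+ 2.
pose I m := iid_gauss_int sigma2
  (fun z => (\1_[set z' | psi (tadd (f m) z') != m] z)%:E).
have I0 m : (0 <= I m)%E by apply: iid_gauss_int_ge0 => z; exact: indic_psi_ge0.
have I1 m : (I m <= 1)%E.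
  rewrite -(@iid_gauss_int_cst R sigma2 n 1%E); apply: iid_gauss_int_le => z.
    exact: indic_psi_ge0.
  by rewrite lee_fin indicE; case: (_ \in _).
have If m : I m = (fine (I m))%:E.
  by rewrite fineK// ge0_fin_numE// (le_lt_trans (I1 m)) ?ltry.
pose e m := fine (I m).
have e0 m : 0 <= e m by apply: fine_ge0.
have S0 m : 0 <= S m by apply: sumr_ge0 => i _; exact: sqr_ge0.
have sumS : \sum_m S m <= M%:R * (n%:R * P).
  move: hpow; rewrite /code_power_ok /expect_mZ.
  under eq_bigr do under eq_bigr do rewrite iid_gauss_int_cst.
  under eq_bigr do rewrite sumEFin -EFinM.
  rewrite sumEFin lee_fin -mulr_sumr exchange_big/=.
  by rewrite mulrC ler_pdivrMr// mulrC.
have sume : \sum_m e m <= M%:R * p.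
  move: herr; rewrite /code_Pe /expect_mZ.
  under eq_bigr do rewrite -/(I _) If.
  by rewrite sumEFin -EFinM lee_fin mulrC ler_pdivrMr// mulrC.
pose w m := S m / (n%:R * P) + kappa * (e m / p).
have w0 m : 0 <= w m.
  apply: addr_ge0; first exact: divr_ge0 (ltW nP0).
  by apply: mulr_ge0; [exact: ltW|exact: divr_ge0 (ltW p0)].
have sumw : \sum_m w m <= M%:R * (1 + kappa).
  rewrite big_split/= -mulr_suml -mulr_sumr -mulr_suml mulrDr mulr1 lerD//.
    by rewrite ler_pdivrMr.
  by rewrite mulrC ler_pM2r// ler_pdivrMr.
(* Each discarded codeword weighs more than [1 + 2 kappa] while the weights sum to at most
   [M (1 + kappa)], so a fraction [kappa / (1 + 2 kappa)] survives. *)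
pose G := [set m : 'I_M | w m <= 1 + 2 * kappa]%SET.
have cardG : kappa * M%:R <= (1 + 2 * kappa) * #|G|%:R.
  have : (1 + 2 * kappa) * #|~: G|%SET%:R <= \sum_m w m.
    rewrite (bigID (mem G))/= -[leLHS]add0r lerD ?sumr_ge0//.
    rewrite mulr_natr -sumr_const big_mkcond [leRHS]big_mkcond/=.
    apply: ler_sum => m _; rewrite !inE -ltNge.
    by case: ifPn => // /ltW.
  rewrite cardsCs finset.setCK card_ord natrB ?max_card//; last first.
    by rewrite -[X in (_ <= X)%N](card_ord M) max_card.
  by move: sumw; lra.
exists #|G|; split => //.
have /card_gt0P [x0 x0G] : (0 < #|G|)%N.
  rewrite -(ltr0n R) -(pmulr_rgt0 _ (_ : 0 < 1 + 2 * kappa)); last lra.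
  by apply: lt_le_trans cardG; rewrite mulr_gt0.
have hG (i : 'I_#|G|) : w (enum_val i) <= 1 + 2 * kappa.
  by have := enum_valP i; rewrite inE.
(* Decisions for discarded codewords are sent to the survivor [x0]; wherever the old decoder was
   right, so is the new one. *)
exists (fun i => f (enum_val i)), (enum_rank_in x0G \o psi); split => i.
- exact: (fibers_measurable_comp (enum_rank_in x0G) psi mpsi).
- rewrite -ler_pdivrMr//; apply: le_trans (hG i).
  by rewrite lerDl; apply: mulr_ge0; [exact: ltW|exact: divr_ge0 (ltW p0)].
apply: (@le_trans _ _ (I (enum_val i))).
  apply: iid_gauss_int_le => z; first exact: indic_psi_ge0.
  rewrite lee_fin !indicE ler_nat.
  case: (boolP (z \in [set z' | psi (tadd (f (enum_val i)) z') != _])) => [_|].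
    exact: leq_b1.
  rewrite notin_setE/= => /negP/negPn/eqP eq_psi.
  by rewrite memNset//= eq_psi enum_valK_in eqxx.
rewrite If lee_fin -/(e _) mulrAC ler_pdivlMr// mulrC -ler_pdivrMr// -mulrA.
apply: le_trans (hG i).
by rewrite lerDr; exact: divr_ge0 (ltW nP0).
Qed.
End max_code.

(** * Combining a code with a quantizer *)

Section combine.
Local Open Scope classical_set_scope.
Context {R : realType} (sigma2 : R).
Notation gauss := (normal_prob 0 (Num.sqrt sigma2)).

Lemma average_le (M : nat) (x : 'I_M -> \bar R) (c : R) : (0 < M)%N ->
  (forall m, x m <= c%:E)%E -> ((M%:R^-1)%:E * \sum_(m < M) x m <= c%:E)%E.
Proof.
move=> M0 xc; have MR : 0 < M%:R :> R by rewrite ltr0n.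
apply: (@le_trans _ _ ((M%:R^-1)%:E * \sum_(m < M) c%:E)%E).
  apply: lee_wpmul2l; first by rewrite lee_fin invr_ge0 ltW.
  by apply: lee_sum => m _; exact: xc.
rewrite sumEFin -EFinM lee_fin sumr_const card_ord -[c *+ M]mulr_natl.
by rewrite mulKf// gt_eqF.
Qed.

Lemma tadd_cons n (c0 x : R) (c t : n.-tuple R) :
  tadd [tuple of c0 :: c] [tuple of x :: t] = [tuple of c0 + x :: tadd c t].
Proof.
rewrite /tadd cons_mktuple !tnth0; congr [tuple of _ :: _].
by apply: eq_from_tnth => i; rewrite !tnth_mktuple !tnth_cons_lift.
Qed.

Section product_scheme.
Variables (n M M' K K' : nat) (P S p q p' : R).
Variables (f : 'I_M' -> n.-tuple R) (psi : n.-tuple R -> 'I_M').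
Variables (T : R -> 'I_K) (enc : 'I_K' -> 'I_K -> R) (dec : R -> 'I_K').
Variables (g : 'I_M -> 'I_M' * 'I_K') (h : 'I_M' * 'I_K' -> 'I_M) (E : set R).
Hypotheses (gK : cancel g h) (M_gt0 : (0 < M)%N).
Hypothesis mpsi : forall m, measurable (psi @^-1` [set m]).
Hypotheses (mT : fibers_measurable T) (mdec : fibers_measurable dec).
Hypotheses (mE : measurable E) (gE : (gauss E <= p'%:E)%E).
Hypothesis fS : forall m, \sum_(i < n) tnth (f m) i ^+ 2 <= S.
Hypothesis encq : forall m, (\int[gauss]_z ((enc m (T z)) ^+ 2)%:E <= q%:E)%E.
Hypothesis decK : forall m z, ~ E z -> dec (enc m (T z) + z) = m.
Hypothesis psip : forall m, (iid_gauss_int sigma2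
  (fun z => (\1_[set z' | psi (tadd (f m) z') != m] z)%:E) <= p%:E)%E.

(** The helped coordinate comes first, so that one unfolding of [iid_gauss_int] isolates it. *)
Definition prod_enc (m : 'I_M) (k : 'I_K) : n.+1.-tuple R :=
  [tuple of enc (g m).2 k :: f (g m).1].
Definition prod_help (z : n.+1.-tuple R) : 'I_K := T (thead z).
Definition prod_dec (y : n.+1.-tuple R) : 'I_M :=
  h (psi [tuple of behead y], dec (thead y)).

Lemma measurable_thead : measurable_fun [set: n.+1.-tuple R] (@thead n R).
Proof. exact: measurable_tnth. Qed.

Lemma fibers_prod_help : fibers_measurable prod_help.
Proof. exact: (fibers_measurable_fun _ _ measurable_thead mT). Qed.

Lemma fibers_prod_dec : fibers_measurable prod_dec.
Proof.
apply: (fibers_measurable_comp h (fun y : n.+1.-tuple R =>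
  (psi [tuple of behead y], dec (thead y)))).
apply: fibers_measurable_pair.
  exact: (@fibers_measurable_fun _ _ _ _ _ _ psi (@measurable_behead _ _ n) mpsi).
exact: (fibers_measurable_fun _ _ measurable_thead mdec).
Qed.

Lemma prod_power_ok : S + q <= n.+1%:R * P ->
  helped_power_ok P sigma2 prod_enc prod_help.
Proof.
move=> Sq; rewrite /helped_power_ok /expect_mZ.
have I0 i m : (0 <= iid_gauss_int sigma2 (fun z : n.+1.-tuple R =>
    (tnth (prod_enc m (prod_help z)) i ^+ 2)%:E))%E.
  by apply: iid_gauss_int_ge0 => z; rewrite lee_fin sqr_ge0.
(* Exchanging the sums reduces the constraint to an energy bound for each message. *)
rewrite -ge0_sume_distrr; last by move=> i _; apply: sume_ge0 => m _; exact: I0.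
rewrite exchange_big; apply: average_le => // m.
rewrite big_ord_recl.
rewrite (_ : iid_gauss_int _ _ = \int[gauss]_z ((enc (g m).2 (T z)) ^+ 2)%:E)%E; last first.
  rewrite -(iid_gauss_int_head sigma2 n (fun z => ((enc (g m).2 (T z)) ^+ 2)%:E)).
  by congr (iid_gauss_int _ _).
apply: (@le_trans _ _ (q%:E + (S)%:E)%E); last by rewrite -EFinD lee_fin addrC.
apply: leeD => //.
under eq_bigr => i _.
  rewrite (_ : (fun z => _) = (fun=> (tnth (f (g m).1) i ^+ 2)%:E)); last first.
    by apply/funext => z; rewrite tnth_cons_lift.
  rewrite iid_gauss_int_cst; over.
by rewrite sumEFin lee_fin.
Qed.

(** Union bound, conditionally on the first noise value: on [E] the error is at most 1, and off [E]
    only the code can fail. *)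
Lemma prod_Pe : (helped_Pe sigma2 prod_enc prod_dec prod_help <= (p + p')%:E)%E.
Proof.
rewrite /helped_Pe /expect_mZ; apply: average_le => // m.
have p0 : (0 <= p%:E)%E.
  by apply: le_trans (psip (g m).1); apply: iid_gauss_int_ge0 => z; exact: indic_psi_ge0.
rewrite iid_gauss_intS.
apply: (@le_trans _ _ (\int[gauss]_x ((\1_E x)%:E + p%:E))%E).
  apply: ge0_le_integral_nomeas => x.
    by apply: iid_gauss_int_ge0 => t; exact: indic_psi_ge0.
  have [xE|xE] := boolP (x \in E).
    rewrite [X in (_ <= X + _)%E](_ : _ = 1%E); last by rewrite indicE xE.
    apply: (@le_trans _ _ 1%E); last by rewrite leeDl.
    rewrite -(@iid_gauss_int_cst R sigma2 n 1%E); apply: iid_gauss_int_le => z.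
      exact: indic_psi_ge0.
    by rewrite lee_fin indicE; case: (_ \in _).
  rewrite [X in (_ <= X + _)%E](_ : _ = 0%E); last by rewrite indicE (negbTE xE).
  rewrite add0e; apply: le_trans (psip (g m).1); apply: iid_gauss_int_le => z.
    exact: indic_psi_ge0.
  rewrite lee_fin !indicE ler_nat.
  case: (boolP (z \in [set z' | psi (tadd (f (g m).1) z') != _])) => [_|].
    exact: leq_b1.
  rewrite notin_setE/= => /negP/negPn/eqP eq_psi.
  rewrite memNset//= /prod_enc /prod_help /prod_dec tadd_cons !theadE.
  rewrite decK; last by move: xE; rewrite notin_setE.
  have -> : [tuple of behead [tuple of enc (g m).2 (T x) + x :: tadd (f (g m).1) z]]
    = tadd (f (g m).1) z by exact: val_inj.
  by rewrite eq_psi -surjective_pairing gK eqxx.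
rewrite ge0_integralD//; last by apply/measurable_EFinP; exact: measurable_indic.
rewrite integral_indic// setIT integral_cst// [X in (_ * X)%E](_ : _ = 1%E); last first.
  exact: (@probability_setT _ _ _ (normal_prob 0 (Num.sqrt sigma2))).
by rewrite mule1 addeC EFinD; exact: leeD2l.
Qed.
End product_scheme.

Lemma helped_of_max_code (n M M' K K' : nat) (P S p q p' : R) :
  (0 < M <= M' * K')%N -> S + q <= n.+1%:R * P ->
  max_code sigma2 n M' S p -> scalar_scheme sigma2 K K' q p' ->
  exists (phi : 'I_M -> 'I_K -> n.+1.-tuple R) (psi : n.+1.-tuple R -> 'I_M)
         (T : n.+1.-tuple R -> 'I_K),
    helped_scheme_ok P sigma2 phi psi T /\
    (helped_Pe sigma2 phi psi T <= (p + p')%:E)%E.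
Proof.
move=> /andP[M0 MMK] Sq [f [psi [mpsi fS psip]]].
move=> [T [enc [dec [E [mT mdec [mE gE] encq decK]]]]].
have cM : (M <= #|{: 'I_M' * 'I_K'}|)%N by rewrite card_prod !card_ord.
pose g (m : 'I_M) : 'I_M' * 'I_K' := enum_val (widen_ord cM m).
have gI : injective g.
  by move=> x y /enum_val_inj/(congr1 val)/= xy; exact: val_inj.
(* Pairs outside the image of [g] decode to an arbitrary message. *)
pose h p := odflt (Ordinal M0) [pick m | g m == p].
have gK : cancel g h.
  move=> m; rewrite /h; case: pickP => [m' /eqP/gI//|/(_ m)].
  by rewrite eqxx.
exists (prod_enc n M M' K K' f enc g), (prod_dec n M M' K' psi dec h), (prod_help n K T).
split; last exact: (prod_Pe _ _ _ _ _ _ _ _ _ _ _ _ _ _ E).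
split; first exact: fibers_prod_help.
split; first exact: fibers_prod_dec.
exact: prod_power_ok fS encq Sq.
Qed.
End combine.

(** * Exponents *)

Section exponents.
Local Open Scope classical_set_scope.
Context {R : realType}.

Lemma msize_ge (n : nat) (r : R) : expR (n%:R * r) <= (msize n r)%:R.
Proof.
have c0 : 0 <= Num.ceil (expR (n%:R * r)).
  by rewrite ceil_ge0 (lt_trans _ (expR_gt0 _)).
by rewrite /msize natr_absz ger0_norm// ceil_ge.
Qed.

Lemma msize_le (n : nat) (r : R) : (msize n r)%:R <= expR (n%:R * r) + 1.
Proof.
have c0 : 0 <= Num.ceil (expR (n%:R * r)).
  by rewrite ceil_ge0 (lt_trans _ (expR_gt0 _)).
rewrite /msize natr_absz ger0_norm//.
have /andP[+ _] := ceil_itv (expR (n%:R * r)).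
by rewrite intrB mulr1z ltrBlDr => /ltW.
Qed.

Lemma msize_gt0 (n : nat) (r : R) : (0 < msize n r)%N.
Proof. by rewrite -(ltr0n R); exact: lt_le_trans (expR_gt0 _) (msize_ge n r). Qed.

(** Rounding down a number that is at least 1 loses at most a factor 2. *)
Lemma hsize_ge (n : nat) (rh : R) : 0 <= rh -> expR (n%:R * rh) <= 2 * (hsize n rh)%:R.
Proof.
move=> rh0; have e1 : 1 <= expR (n%:R * rh).
  by rewrite -[leLHS]expR0 ler_expR mulr_ge0.
have f0 : 1 <= Num.floor (expR (n%:R * rh)) by rewrite floor_ge_int.
rewrite /hsize natr_absz ger0_norm; last exact: le_trans f0.
have /andP[_ h] := floor_itv (expR (n%:R * rh)).
have : (1 : R) <= (Num.floor (expR (n%:R * rh)))%:~R by rewrite -[leLHS]/(1%:~R) ler_int.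
by move: h; rewrite intrD mulr1z; lra.
Qed.

Lemma hsize_gt0 (n : nat) (rh : R) : 0 <= rh -> (0 < hsize n rh)%N.
Proof.
move=> /(hsize_ge n); rewrite -(ltr0n R) => h.
by rewrite -(pmulr_rgt0 _ (ltr0n R 2)); apply: lt_le_trans h; exact: expR_gt0.
Qed.

(** The quantizer needs at least one cell per shell. *)
Lemma hsize_gt1 (n : nat) (rh : R) : 0 < rh -> 2 / rh <= n%:R -> (1 < hsize n rh)%N.
Proof.
move=> rh0; rewrite ler_pdivrMr// => nrh; rewrite -(ltr_nat R).
have := hsize_ge n rh (ltW rh0); have := expR_ge1Dx (n%:R * rh).
by lra.
Qed.

Lemma reliability_ge (P sigma2 rh r b : R) (n0 : nat) :
  (forall n, (n0 <= n)%N ->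
    exists (phi : 'I_(msize n r) -> 'I_(hsize n rh) -> n.-tuple R)
      (psi : n.-tuple R -> 'I_(msize n r)) (T : n.-tuple R -> 'I_(hsize n rh)),
      helped_scheme_ok P sigma2 phi psi T /\
      (helped_Pe sigma2 phi psi T <= (expR (- (n%:R * b)))%:E)%E) ->
  (b%:E <= reliability P sigma2 rh r)%E.
Proof.
move=> H; rewrite /reliability /limn_esup /limf_esup.
apply: le_ereal_inf_tmp => _ [V [N _ NV] <-].
(* One suitable length in each neighbourhood of infinity suffices for a limit superior; the
   successor makes [n] positive. *)
pose n := (maxn N n0).+1.
apply: (@le_trans _ _ (neg_log_rate n (helped_Pe_inf P sigma2 rh r n))); last first.
  apply: ereal_sup_ubound; exists n => //; apply: NV => /=.
  by rewrite /n ltnW// ltnS leq_maxl.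
have n0R : 0 < n%:R :> R by rewrite ltr0n.
have [phi [psi [T [ok Pe]]]] := H n (leq_trans (leq_maxr N n0) (leqnSn _)).
have infle : (helped_Pe_inf P sigma2 rh r n <= (expR (- (n%:R * b)))%:E)%E.
  by apply: le_trans Pe; apply: ereal_inf_lbound; exists phi, psi, T.
have inf0 : (0 <= helped_Pe_inf P sigma2 rh r n)%E.
  apply: le_ereal_inf_tmp => _ [phi' [psi' [T' [_ ->]]]].
  rewrite /helped_Pe /expect_mZ mule_ge0 ?lee_fin ?invr_ge0//.
  apply: sume_ge0 => m _; apply: iid_gauss_int_ge0 => z; exact: indic_psi_ge0.
rewrite /neg_log_rate; case: eqP => [_|p0]; first exact: leey.
case: (helped_Pe_inf P sigma2 rh r n) infle inf0 p0 => [x| |]//.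
rewrite !lee_fin => xe x0 xn0.
have xp : 0 < x by rewrite lt_neqAle x0 andbT eq_sym; apply/eqP => xx; apply: xn0; rewrite xx.
rewrite /= -mulrN ler_pdivlMl// lerNr -(expRK (- _)).
by rewrite ler_ln ?posrE ?expR_gt0//.
Qed.

(** The zero codeword with constant help and decision is admissible, and its error is at most 1. *)
Lemma reliability_ge0 (P sigma2 rh r : R) : 0 <= P -> 0 <= rh ->
  (0 <= reliability P sigma2 rh r)%E.
Proof.
move=> P0 rh0; apply: (reliability_ge _ _ _ _ _ 0) => n _.
pose k0 := Ordinal (hsize_gt0 n rh rh0); pose m0 := Ordinal (msize_gt0 n r).
exists (fun _ _ => [tuple 0 | _ < n]), (fun=> m0), (fun=> k0).
have mcst (J : Type) (j i : J) : measurable ((fun _ : n.-tuple R => j) @^-1` [set i]).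
  by have := fibers_measurable_comp (fun=> j) (fun _ : n.-tuple R => tt); apply => -[];
     rewrite (_ : _ @^-1` _ = setT)//; apply/seteqP.
split.
  split; first by move=> t; exact: mcst.
  split; first by move=> m; exact: mcst.
  rewrite /helped_power_ok /expect_mZ big1 ?lee_fin ?mulr_ge0// => i _.
  rewrite big1 ?mule0// => m _.
  by under eq_fun => z do rewrite tnth_mktuple expr0n; rewrite iid_gauss_int_cst.
rewrite mulr0 oppr0 expR0 /helped_Pe /expect_mZ; apply: average_le => [|m].
  exact: msize_gt0.
rewrite -(@iid_gauss_int_cst R sigma2 n 1%E); apply: iid_gauss_int_le => z.
  exact: indic_psi_ge0.
by rewrite lee_fin indicE; case: (_ \in _).
Qed.

Lemma reliability_below_help (P sigma2 rh r b : R) :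
  0 < P -> 0 < sigma2 -> 0 < rh -> r < rh -> 0 < b ->
  (b%:E <= reliability P sigma2 rh r)%E.
Proof.
move=> P0 s0 rh0 rrh b0.
(* The 4 covers the two integer roundings, of the message set and of the help alphabet; the extra 1
   in the exponent absorbs the prefactor 2. *)
have [|n1 hn1] := scalar_scheme_exists sigma2 s0 4 P (b + 1) P0; first by rewrite addr_gt0.
apply: (reliability_ge _ _ _ _ _ (maxn n1 (Num.truncn (2 / rh)).+1)) => -[|n];
  first by rewrite geq_max ltn0 andbF.
rewrite geq_max => /andP[n1n n2n].
have n2 : 2 / rh <= n.+1%:R.
  by apply: (le_trans (ltW (truncnS_gt _))); rewrite ler_nat.
set K := hsize n.+1 rh; set M := msize n.+1 r.
have K1 : (1 < K)%N by exact: hsize_gt1.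
have MK : (M <= 1 * (4 * K))%N.
  rewrite mul1n -(ler_nat R) natrM.
  have := msize_le n.+1 r; have := hsize_ge n.+1 rh (ltW rh0).
  have : expR (n.+1%:R * r) <= expR (n.+1%:R * rh) by rewrite ler_expR ler_pM2l// ltW.
  have : 1 <= expR (n.+1%:R * rh) by rewrite -[leLHS]expR0 ler_expR mulr_ge0// ltW.
  rewrite -/K -/M; lra.
have sch : scalar_scheme sigma2 K (4 * K) (n.+1%:R * P) (2 * expR (- (n.+1%:R * (b + 1)))).
  by apply: hn1 => //; rewrite leqnn andbT muln_gt0/= ltnW.
have [|| phi [psi [T [ok Pe]]]] :=
    helped_of_max_code sigma2 n M 1 K (4 * K) P 0 0 _ _ _ _ (max_code_trivial sigma2 n) sch.
- by rewrite msize_gt0.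
- by rewrite add0r.
exists phi, psi, T; split => //; apply: (le_trans Pe).
rewrite lee_fin add0r mulrDr mulr1 opprD expRD mulrCA ler_piMr ?expR_ge0//.
rewrite expRN -ler_pdivlMr ?invr_gt0 ?expR_gt0// invrK mul1r.
have := expR_ge1Dx (n.+1%:R : R); have : (1 : R) <= n.+1%:R by rewrite ler1n.
lra.
Qed.
End exponents.

(** * Rates above the help rate *)

Section above_help.
Context {R : realType}.

(** Contraction outweighs the expurgation slack, as [(1 - eta)^2 (1 + eta) <= 1 - eta]; a fraction
    [eta] of the power is left for the helped coordinate. *)
Lemma power_budget (eta S P N : R) : 0 < eta -> eta <= 1 -> 0 <= P -> 0 <= N ->
  (1 - eta) ^+ 2 * ((1 + eta) * (N * P)) + (N + 1) * (eta * P) <= (N + 1) * P.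
Proof.
move=> e0 e1 P0 N0; have NP : 0 <= N * P by rewrite mulr_ge0.
have h : (1 - eta) ^+ 2 * (1 + eta) <= 1 - eta.
  rewrite expr2 -mulrA ler_piMr ?subr_ge0// -subr_sqr.
  by rewrite expr1n gerBl sqr_ge0.
have : (1 - eta) ^+ 2 * (1 + eta) * (N * P) <= (1 - eta) * (N * P) by rewrite ler_wpM2r.
have : eta * P <= P by rewrite ler_piMl.
by rewrite mulrA; lra.
Qed.

Lemma mul_expR_le (c x y : R) : 0 < c -> c - 1 <= x - y -> c * expR (- x) <= expR (- y).
Proof.
move=> c0 cxy; have -> : - y = (x - y) + - x by ring.
rewrite expRD ler_pM2r ?expR_gt0//.
by apply: le_trans (expR_ge1Dx _); lra.
Qed.

Lemma reliability_above_help (P sigma2 Rh r eps : R) (Ea : R -> R) :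
  0 < P -> 0 < sigma2 -> 0 < Rh -> achievable_exponent P sigma2 Ea ->
  Rh < r -> 0 < eps ->
  ((Ea (r - Rh) - eps)%:E <= reliability P sigma2 Rh r)%E.
Proof.
move=> P0 s0 Rh0 hEa Rhr eps0; set rho := r - Rh; set b := Ea rho - eps.
have rho0 : 0 < rho by rewrite subr_gt0.
have g0 : 0 < 1 + 2 * (P / sigma2) by rewrite addr_gt0// mulr_gt0// divr_gt0.
(* The expurgated energy is at most [2 n P], so the change of measure costs at most [n eps / 4] in
   the exponent. *)
pose eta := Num.min 1 (eps / 4 / (1 + 2 * (P / sigma2))).
have e0 : 0 < eta by rewrite lt_min ltr01 !divr_gt0.
have e1 : eta <= 1 by rewrite ge_min lexx.
have eg : eta * (1 + 2 * (P / sigma2)) <= eps / 4.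
  by rewrite -ler_pdivlMr// ge_min lexx orbT.
pose kappa := eta / 2.
have k0 : 0 < kappa by rewrite divr_gt0.
have kE : 1 + 2 * kappa = 1 + eta by rewrite /kappa; field.
pose C := (1 + eta) / kappa.
have C0 : 0 < C by rewrite divr_gt0// addr_gt0.
(* [C] pays for the lost codewords, 4 for the two roundings, and [expR rho] for the code having
   length [n] instead of [n.+1]. *)
pose L := (Num.truncn (4 * C * expR rho)).+1.
have hL : 4 * C * expR rho <= L%:R by rewrite ltW// truncnS_gt.
pose B := `|Ea rho| + 1.
have B0 : 0 < B by rewrite ltr_wpDl.
have bB : b + 1 <= B by rewrite /b /B lerD2r; have := ler_norm (Ea rho); lra.
have [|n1 hn1] := scalar_scheme_exists sigma2 s0 L (eta * P) B _ B0.
  by rewrite mulr_gt0.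
have [n2 _ hn2] := hEa rho (eps / 4) (divr_gt0 eps0 (ltr0n R 4)).
(* The first term absorbs the prefactor [2 C] and the passage from [n] to [n.+1]; the second
   provides two help values. *)
pose t := (2 * C + `|b|) / (eps / 2) + 2 / Rh.
have t1 : 0 <= (2 * C + `|b|) / (eps / 2).
  apply: divr_ge0; last by rewrite ltW// divr_gt0.
  by apply: addr_ge0 => //; rewrite ltW// mulr_gt0.
have t2 : 0 <= 2 / Rh by rewrite ltW// divr_gt0.
apply: (reliability_ge _ _ _ _ _ (maxn n1 (maxn n2 (maxn 3 (Num.truncn t).+1))).+1) => -[//|n].
rewrite ltnS !geq_max => /and4P[n1n n2n n3 tn].
have {}tn : t <= n%:R.
  by apply: (le_trans (ltW (truncnS_gt _))); rewrite ler_nat.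
have nR0 : 0 <= n%:R :> R by [].
have n0 : (0 < n)%N by exact: leq_trans n3.
have [f [psi [mpsi [hpow herr]]]] := hn2 n n2n.
set p := expR _ in herr.
have [M' [hM' code]] := max_code_expurgate sigma2 n _ P p kappa f psi
  P0 (expR_gt0 _) k0 n0 (msize_gt0 n rho) mpsi hpow herr.
rewrite kE -/C in hM' code.
have {}code := max_code_shrink sigma2 s0 n M' _ _ eta e0 e1 code.
set K := hsize n.+1 Rh; set M := msize n.+1 r.
have RhN : 2 / Rh <= n.+1%:R.
  by rewrite -(natr1 n); move: tn; rewrite /t; lra.
have K1 : (1 < K)%N by exact: hsize_gt1.
have MMK : (0 < M <= M' * (L * K))%N.
  rewrite msize_gt0/= -(ler_nat R) !natrM.
  have hM : M%:R <= 2 * expR (n.+1%:R * r).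
    have := msize_le n.+1 r; have : 1 <= expR (n.+1%:R * r).
      by rewrite -[leLHS]expR0 ler_expR mulr_ge0// ltW// (lt_trans Rh0).
    rewrite -/M; lra.
  apply: (le_trans hM).
  have -> : n.+1%:R * r = n%:R * rho + (n.+1%:R * Rh + rho).
    by rewrite /rho -natr1; ring.
  rewrite expRD expRD.
  have m1 : expR (n%:R * rho) <= C * M'%:R.
    apply: (le_trans (msize_ge n rho)).
    by rewrite /C mulrAC ler_pdivlMr// mulrC.
  have m2 : expR (n.+1%:R * Rh) <= 2 * K%:R by apply: hsize_ge; exact: ltW.
  apply: (@le_trans _ _ (2 * ((C * M'%:R) * ((2 * K%:R) * expR rho)))).
    rewrite ler_pM2l//; apply: ler_pM; rewrite ?expR_ge0 ?mulr_ge0 ?expR_ge0//.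
    by rewrite ler_pM2r ?expR_gt0.
  rewrite [leLHS](_ : _ = (M'%:R * K%:R) * (4 * C * expR rho)); last by ring.
  rewrite [leRHS](_ : _ = (M'%:R * K%:R) * L%:R); last by ring.
  by rewrite ler_wpM2l// mulr_ge0.
have sch : scalar_scheme sigma2 K (L * K) (n.+1%:R * (eta * P))
    (2 * expR (- (n.+1%:R * B))).
  by apply: hn1; rewrite ?(leqW n1n)// leqnn andbT muln_gt0/= ltnW.
have budget : (1 - eta) ^+ 2 * ((1 + eta) * (n%:R * P)) + n.+1%:R * (eta * P) <= n.+1%:R * P.
  by rewrite -(natr1 n); apply: power_budget => //; exact: ltW.
have [phi [psi' [T [ok Pe]]]] :=
  helped_of_max_code sigma2 n M M' K (L * K) P _ _ _ _ MMK budget code sch.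
exists phi, psi', T; split => //; apply: (le_trans Pe); rewrite lee_fin.
(* Code error and quantizer overflow each get half of the target. *)
have -> : expR (- (n.+1%:R * b)) =
    2^-1 * expR (- (n.+1%:R * b)) + 2^-1 * expR (- (n.+1%:R * b)) by field.
apply: lerD.
(* The total loss [eps / 2] is [eps / 4] from the code and [eps / 4] from the change of measure. *)
- apply: (@le_trans _ _ (C * expR (- (n%:R * (Ea rho - eps / 2))))).
    rewrite mulrCA ler_pM2l// /p -expRD ler_expR.
    have : eta * (n%:R + (1 + eta) * (n%:R * P) / sigma2) <= n%:R * (eps / 4).
      apply: (@le_trans _ _ (n%:R * (eta * (1 + 2 * (P / sigma2))))); last exact: ler_wpM2l.
      rewrite [leRHS]mulrCA ler_pM2l//.
      rewrite [leLHS](_ : _ = n%:R * (1 + (1 + eta) * (P / sigma2))); last first.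
        by field; rewrite gt_eqF.
      rewrite ler_wpM2l// lerD2l ler_wpM2r ?divr_ge0 ?(ltW P0) ?(ltW s0)//; lra.
    by lra.
  rewrite -ler_pdivrMl ?invr_gt0// invrK mulrA; apply: mul_expR_le.
    by rewrite mulr_gt0.
  have : (2 * C + `|b|) <= n%:R * (eps / 2).
    by rewrite -ler_pdivrMr ?divr_gt0//; move: tn; rewrite /t; lra.
  have := ler_norm b; rewrite -(natr1 n) /b; lra.
- rewrite -ler_pdivrMl ?invr_gt0// invrK mulrA; apply: mul_expR_le.
    by rewrite mulr_gt0.
  rewrite -mulrBr; apply: (@le_trans _ _ (n.+1%:R * 1)).
    by rewrite mulr1 -natr1; move: n3; rewrite -(ler_nat R); lra.
  by rewrite ler_wpM2l//; lra.
Qed.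
End above_help.

Theorem theorem1 (R : realType) (P sigma2 Rh : R) (Ea : R -> R)
  (hP : 0 < P) (hsigma2 : 0 < sigma2) (hRh : 0 < Rh)
  (hEa : achievable_exponent P sigma2 Ea) (r : R) :
  (r < Rh -> reliability P sigma2 Rh r = +oo%E) /\
  (Rh < r < Rh + capacity P sigma2 ->
     ((Ea (r - Rh))%:E <= reliability P sigma2 Rh r)%E) /\
  (Rh + capacity P sigma2 <= r -> (0 <= reliability P sigma2 Rh r)%E).
Proof.
split; [|split].
- move=> rRh; apply/eqyP => b b0.
  exact: reliability_below_help.
- move=> /andP[Rhr _]; apply/lee_subgt0Pr => eps eps0.
  by rewrite -EFinB; exact: reliability_above_help.
- by move=> _; apply: reliability_ge0; exact: ltW.
Qed.
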